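(* Let $M\subseteq\mathbb{R}^m$ be a nonempty convex set, let $F:M\to L(E^n)$ be a convex fuzzy $n$-cell number-valued function and let $x_0\in M$. Then $x_0$ is a minimum solution of $\min_{x\in M}F(x)$ (that is, $F(x)\ge F(x_0)$ for all $x\in M$) if and only if $(\hat 0,\hat 0,\dots,\hat 0)\in\partial F(x_0)$.
   Context: A fuzzy set is a function $u:\mathbb{R}^n\to[0,1]$; its level sets are $[u]^r=\{x:u(x)\ge r\}$ for $r\in(0,1]$ and $[u]^0=\overline{\{x:u(x)>0\}}$. $u$ is a fuzzy number ($u\in E^n$) if $u(x_0)=1$ for some $x_0$, $u(\lambda x+(1-\lambda)y)\ge\min(u(x),u(y))$ for all $x,y$ and $\lambda\in[0,1]$, $u$ is upper semicontinuous, and $[u]^0$ is compact. $L(E^n)$ (the fuzzy $n$-cell numbers) is the set of $u\in E^n$ with $[u]^r=\prod_{i=1}^n[u_i^-(r),u_i^+(r)]$ for all $r\in[0,1]$. Addition and scalar multiplication are levelwise: $[u+v]^r=[u]^r+[v]^r$, $[ku]^r=k[u]^r$. $\hat 0\in L(E^n)$ is the indicator function of the point $0$. Order on $L(E^n)$: $u\le v$ iff $u_i^-(r)\le v_i^-(r)$ and $u_i^+(r)\le v_i^+(r)$ for all $i$ and all $r\in[0,1]$. $F:M\to L(E^n)$, $M$ convex, is convex if $F(\lambda x+(1-\lambda)y)\le\lambda F(x)+(1-\lambda)F(y)$ for all $x,y\in M$, $\lambda\in[0,1]$. For boxes $A,B$ in $\mathbb{R}^n$, $A\ominus_{gH}B=C$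 means $A=B+C$ or $B=A+(-1)C$. The $g$-difference $u\ominus_g v$ is the fuzzy number with level sets $[u\ominus_g v]^r=\mathrm{cl}\big(\mathrm{conv}\bigcup_{\beta\ge r}([u]^\beta\ominus_{gH}[v]^\beta)\big)$, $r\in[0,1]$; it need not exist. If it exists for $u,v\in L(E^n)$, then $[u\ominus_g v]^r=\prod_{i=1}^n[\inf_{\beta\ge r}\min\{u_i^-(\beta)-v_i^-(\beta),u_i^+(\beta)-v_i^+(\beta)\},\ \sup_{\beta\ge r}\max\{u_i^-(\beta)-v_i^-(\beta),u_i^+(\beta)-v_i^+(\beta)\}]$. For $v=(v_1,\dots,v_m)\in(L(E^n))^m$ and $d\in\mathbb{R}^m$, $v\cdot d=\sum_{j=1}^m d_jv_j\in L(E^n)$. A vector $v\in(L(E^n))^m$ is a subgradient of $F$ at $t\in M$ if for every $z\in M$ the $g$-difference $F(z)\ominus_gF(t)$ exists and $F(z)\ominus_gF(t)\ge v\cdot(z-t)$; $\partial F(t)$ is the set of all subgradients of $F$ at $t$.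
   Formalization: The formal theorem assumes that the g-differences of F(z) and F(x_0) exist for all z in M; without this a minimum need not have the zero vector as a subgradient, e.g. F(x) = [0,1+x]×[x,1] on M=[0,1] with x_0 = 0. *)

(* Defs.v *)
From mathcomp Require Import all_boot all_order all_algebra.
From mathcomp Require Import all_classical all_reals all_analysis.
From mathcomp Require Import lra.
Import Order.TTheory GRing.Theory Num.Theory.
Import numFieldNormedType.Exports.

Set Implicit Arguments.
Unset Strict Implicit.
Unset Printing Implicit Defensive.

Local Open Scope classical_set_scope.
Local Open Scope ring_scope.

Section sets.
Context {R : realType} {n : nat}.
Implicit Types A B C : set 'rV[R]_n.

Definition set_add A B : set 'rV[R]_n := [set x + y | x in A & y in B].

Definition set_scale (k : R) A : set 'rV[R]_n := [set k *: x | x in A].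

Definition box (a b : 'I_n -> R) : set 'rV[R]_n :=
  [set x | forall i, a i <= x 0 i <= b i].

Definition is_box C := exists a b : 'I_n -> R,
  (forall i, a i <= b i) /\ C = box a b.

Definition conv_hull A : set 'rV[R]_n :=
  \bigcap_(B in [set B | convex_set B /\ A `<=` B]) B.

(* A gH-difference need not exist; it is unique when it does. *)
Definition is_gHdiff A B C :=
  is_box C /\ (A = set_add B C \/ B = set_add A (set_scale (-1) C)).

End sets.

Section fuzzy_numbers.
Context {R : realType} {n : nat}.
Implicit Types (u : 'rV[R]_n -> R) (r : R) (i : 'I_n).

(* Only meaningful for r in [0, 1]. *)
Definition level u r : set 'rV[R]_n :=
  if r == 0 then closure [set x | 0 < u x] else [set x | r <= u x].

Record is_fuzzy_number u : Prop := IsFuzzyNumber {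
  fuzzy_range : forall x, 0 <= u x <= 1 ;
  fuzzy_normal : exists x, u x = 1 ;
  fuzzy_quasiconcave : forall x y (l : R), 0 <= l <= 1 ->
    Num.min (u x) (u y) <= u (l *: x + (1 - l) *: y) ;
  fuzzy_usc : forall x (c : R), u x < c -> \forall y \near x, u y < c ;
  fuzzy_compact : compact (level u 0) }.

(* The endpoints u_i^-(r) and u_i^+(r): the extreme i-th coordinates of the
   level set, which is the box they span when u is an n-cell number. *)
Definition lo u i r := inf [set x 0 i | x in level u r].
Definition hi u i r := sup [set x 0 i | x in level u r].

Definition is_cell u := is_fuzzy_number u /\
  forall r, 0 <= r <= 1 -> level u r = box (lo u ^~ r) (hi u ^~ r).

(* The fuzzy set whose level sets are the A r, for a suitable family A
   (see is_cell_of_levels and level_of_levels); note that sup set0 = 0. *)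
Definition of_levels (A : R -> set 'rV[R]_n) : 'rV[R]_n -> R :=
  fun x => sup [set r | 0 <= r <= 1 /\ A r x].

End fuzzy_numbers.

Record cellnum (R : realType) (n : nat) := CellNum {
  cell_fun :> 'rV[R]_n -> R ;
  cell_funP : is_cell cell_fun }.

Section box_lemmas.
Context {R : realType} {n : nat}.
Implicit Types a b : 'I_n -> R.

Lemma box_lo a b : (forall i, a i <= b i) -> box a b (\row_i a i).
Proof. by move=> ab i; rewrite !mxE lexx ab. Qed.

Lemma box_hi a b : (forall i, a i <= b i) -> box a b (\row_i b i).
Proof. by move=> ab i; rewrite !mxE lexx ab. Qed.

Lemma inf_box a b i : (forall j, a j <= b j) ->
  inf [set x 0 i | x in box a b] = a i.
Proof.
move=> ab; apply/eqP; rewrite eq_le; apply/andP; split.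
- apply: ge_inf; first by exists (a i) => _ [x bx <-]; case/andP: (bx i).
  by exists (\row_j a j); [exact: box_lo|rewrite mxE].
- apply: lb_le_inf; last by move=> _ [x bx <-]; case/andP: (bx i).
  by exists (a i); exists (\row_j a j); [exact: box_lo|rewrite mxE].
Qed.

Lemma sup_box a b i : (forall j, a j <= b j) ->
  sup [set x 0 i | x in box a b] = b i.
Proof.
move=> ab; apply/eqP; rewrite eq_le; apply/andP; split.
- apply: ge_sup; last by move=> _ [x bx <-]; case/andP: (bx i).
  by exists (b i); exists (\row_j b j); [exact: box_hi|rewrite mxE].
- apply: ub_le_sup; first by exists (b i) => _ [x bx <-]; case/andP: (bx i).
  by exists (\row_j b j); [exact: box_hi|rewrite mxE].
Qed.

Lemma box_compact a b : compact (box a b).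
Proof.
have := @rV_compact R n (fun i => `[a i, b i]%classic)
  (fun i => @segment_compact R (a i) (b i)).
by congr (compact _); apply/seteqP; split=> x /= bx i; move: (bx i); rewrite /= in_itv.
Qed.

Lemma box_closed a b : closed (box a b).
Proof.
apply: compact_closed; last exact: box_compact.
exact: norm_hausdorff.
Qed.

Lemma set_add_box a b a' b' :
  (forall i, a i <= b i) -> (forall i, a' i <= b' i) ->
  set_add (box a b) (box a' b')
  = box (fun i => a i + a' i) (fun i => b i + b' i).
Proof.
move=> ab ab'; apply/seteqP; split.
  move=> _ [x bx [y b'y <-]] i; rewrite mxE.
  by case/andP: (bx i) => ? ?; case/andP: (b'y i) => ? ?; rewrite !lerD.
move=> z bz.
pose x : 'rV[R]_n := \row_i Num.max (a i) (z 0 i - b' i).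
have hx i : x 0 i = Num.max (a i) (z 0 i - b' i) by rewrite mxE.
exists x.
  move=> i; rewrite hx; have := ab i; have := bz i.
  by rewrite /Num.max; case: ltP => ? /andP[? ?] ?; apply/andP; split; lra.
exists (z - x); last by rewrite addrC subrK.
move=> i; rewrite !mxE; have := ab' i; have := bz i.
by rewrite /Num.max; case: ltP => ? /andP[? ?] ?; apply/andP; split; lra.
Qed.

Lemma set_scale_box k a b : (forall i, a i <= b i) ->
  set_scale k (box a b)
  = box (fun i => Num.min (k * a i) (k * b i))
        (fun i => Num.max (k * a i) (k * b i)).
Proof.
move=> ab; apply/seteqP; split.
  move=> _ [x bx <-] i; rewrite mxE; case/andP: (bx i) => h1 h2.
  have [k0|k0] := leP 0 k.
    have q1 := ler_wpM2l k0 h1; have q2 := ler_wpM2l k0 h2.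
    by rewrite ge_min le_max q1 q2 orbT.
  have q1 := ler_wnM2l (ltW k0) h1; have q2 := ler_wnM2l (ltW k0) h2.
  by rewrite ge_min le_max q1 q2 orbT.
move=> z bz; have [k0|k0] := eqVneq k 0.
  exists (\row_i a i); first exact: box_lo.
  apply/rowP => i; have := bz i; rewrite !mxE k0 !mul0r minxx maxxx => z0.
  by apply/eqP; rewrite eq_le.
exists (k^-1 *: z); last by rewrite scalerA divff// scale1r.
move=> i; rewrite mxE; have := bz i; rewrite ge_min le_max.
have {1 2 3 4}-> : z 0 i = k * (k^-1 * z 0 i) by rewrite mulrA divff// mul1r.
move: (k^-1 * _) => t; have := ab i.
have [kp|kn] := ltP 0 k.
  rewrite !ler_pM2l// => ?; case/andP => /orP q /orP q'.
  by apply/andP; split; [case: q => ?|case: q' => ?]; lra.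
have {}kn : k < 0 by rewrite lt_neqAle k0.
rewrite !ler_nM2l// => ?; case/andP => /orP q /orP q'.
by apply/andP; split; [case: q' => ?|case: q => ?]; lra.
Qed.

End box_lemmas.

Section levels.
Context {R : realType} {n : nat}.

(* The endpoint functions of the level sets of an n-cell number: a is
   nondecreasing and b nonincreasing, both are left-continuous on ]0, 1] and
   right-continuous at 0. *)
Record endpoints (a b : R -> 'I_n -> R) : Prop := Endpoints {
  ep_le : forall r i, 0 <= r <= 1 -> a r i <= b r i ;
  ep_mono : forall r s i, 0 <= r -> r <= s -> s <= 1 ->
    a r i <= a s i /\ b s i <= b r i ;
  ep_left : forall r i (e : R), 0 < r -> r <= 1 -> 0 < e ->
    exists s, [/\ 0 <= s, s < r, a r i - e < a s i & b s i < b r i + e] ;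
  ep_right : forall i (e : R), 0 < e ->
    exists s, [/\ 0 < s, s <= 1, a s i < a 0 i + e & b 0 i - e < b s i] }.

Section of_levels.
Variables (a b : R -> 'I_n -> R) (A : R -> set 'rV[R]_n).
Hypotheses (ab : endpoints a b)
  (HA : forall r, 0 <= r <= 1 -> A r = box (a r) (b r)).

Let u := of_levels A.

Let S_ub x : has_ubound [set r | 0 <= r <= 1 /\ A r x].
Proof. by exists 1 => r [/andP[]]. Qed.

Let box_mono r s x : 0 <= r -> r <= s -> s <= 1 ->
  box (a s) (b s) x -> box (a r) (b r) x.
Proof.
move=> r0 rs s1 bx i; have [h1 h2] := ep_mono ab i r0 rs s1.
by case/andP: (bx i) => h3 h4; rewrite (le_trans h1)// (le_trans h4).
Qed.

Lemma of_levels_range x : 0 <= u x <= 1.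
Proof.
rewrite /u /of_levels; set S := [set _ | _].
have [->|/set0P S0] := eqVneq S set0; first by rewrite sup0 lexx ler01.
apply/andP; split; last by apply: ge_sup => // r [/andP[]].
have [r Sr] := S0; apply: (@le_trans _ _ r); first by case: Sr => /andP[].
by apply: ub_le_sup => //; exact: S_ub.
Qed.

Lemma of_levelsE r x : 0 < r -> r <= 1 -> (r <= u x) = `[< box (a r) (b r) x >].
Proof.
move=> r0 r1; apply/idP/asboolP; last first.
  by move=> bx; apply: ub_le_sup; [exact: S_ub|rewrite /= HA (ltW r0) ?r1].
rewrite /u /of_levels; set S := [set _ | _] => rS.
have S0 : S !=set0.
  by apply/set0P/eqP => S0; move: rS; rewrite S0 sup0 leNgt r0.
have bs s : 0 <= s -> s < r -> box (a s) (b s) x.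
  move=> s0 sr; have [t St st] := sup_gt S0 (lt_le_trans sr rS).
  case: St => t01; rewrite HA//; case/andP: t01 => t0 t1.
  by apply: box_mono => //; exact: ltW.
move=> i; apply/andP; split; rewrite leNgt; apply/negP => h.
  have e0 : 0 < a r i - x 0 i by rewrite subr_gt0.
  have [s [s0 sr h1 _]] := ep_left ab i r0 r1 e0.
  by case/andP: (bs s s0 sr i) => ? _; lra.
have e0 : 0 < x 0 i - b r i by rewrite subr_gt0.
have [s [s0 sr _ h1]] := ep_left ab i r0 r1 e0.
by case/andP: (bs s s0 sr i) => _ ?; lra.
Qed.

Let level0 : level u 0 = box (a 0) (b 0).
Proof.
rewrite /level eqxx; apply/seteqP; split.
  rewrite [X in _ `<=` X](closure_id _).1; last exact: box_closed.
  apply: closureS => x /= ux; have /andP[_ u1] := of_levels_range x.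
  apply: (@box_mono _ (u x)) => //; first exact: ltW.
  by apply/asboolP; rewrite -of_levelsE.
move=> x bx B /nbhs_ballP[e /= e0 xeB].
have /choice[s Hs] : forall i, exists s, [/\ 0 < s, s <= 1,
    a s i < a 0 i + e & b 0 i - e < b s i] by move=> i; exact: ep_right.
pose r := \big[Num.min/1]_i s i.
have r0 : 0 < r by apply/bigmin_gtP => //; split => // i _; case: (Hs i).
have r1 : r <= 1 by exact: bigmin_le_id.
have r01 : 0 <= r <= 1 by rewrite (ltW r0).
pose y : 'rV[R]_n := \row_i Num.max (a r i) (Num.min (x 0 i) (b r i)).
have yE i : y 0 i = Num.max (a r i) (Num.min (x 0 i) (b r i)) by rewrite mxE.
exists y; split; last first.
  apply: xeB; split => // j i; rewrite (ord1 j) /ball/= yE.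
  have rs : r <= s i by exact: bigmin_le.
  have [s0 s1 h1 h2] := Hs i; have [h3 h4] := ep_mono ab i (ltW r0) rs s1.
  case/andP: (bx i) => h5 h6; have h7 := ep_le ab i r01.
  rewrite ltr_norml /Num.max /Num.min; case: (ltP (x 0 i)) => ?;
    [case: (ltP (a r i) (x 0 i)) => ?|case: (ltP (a r i) (b r i)) => ?];
    apply/andP; split; lra.
rewrite /= (lt_le_trans r0)// of_levelsE//; apply/asboolP => i.
rewrite yE; have h7 := ep_le ab i r01.
rewrite /Num.max /Num.min; case: (ltP (x 0 i)) => ?;
    [case: (ltP (a r i) (x 0 i)) => ?|case: (ltP (a r i) (b r i)) => ?];
    apply/andP; split; lra.
Qed.

Let levelE r : 0 <= r <= 1 -> level u r = box (a r) (b r).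
Proof.
move=> /andP[]; rewrite le_eqVlt => /predU1P[<- _|r0 r1]; first exact: level0.
by rewrite /level gt_eqF//; apply/seteqP; split => x /=;
   rewrite of_levelsE// => /asboolP.
Qed.

Lemma level_of_levels r : 0 <= r <= 1 -> level (of_levels A) r = A r.
Proof. by move=> r01; rewrite HA// -levelE. Qed.

Lemma is_cell_of_levels : is_cell (of_levels A).
Proof.
split; last first.
  move=> r r01; rewrite (levelE r01); congr box; apply/funext => i.
    by rewrite /lo (levelE r01) inf_box// => j; exact: ep_le.
  by rewrite /hi (levelE r01) sup_box// => j; exact: ep_le.
split.
- exact: of_levels_range.
- exists (\row_i a 1 i); apply/eqP; rewrite eq_le.
  case/andP: (of_levels_range (\row_i a 1 i)) => _ -> /=.
  rewrite of_levelsE//; apply/asboolP; apply: box_lo => i; apply: ep_le => //.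
  by rewrite ler01 lexx.
- move=> x y l /andP[l0 l1]; rewrite -/u; set r := Num.min _ _.
  have /andP[u0 _] := of_levels_range (l *: x + (1 - l) *: y).
  have [r0|r0] := leP r 0; first exact: le_trans u0.
  have r1 : r <= 1.
    by rewrite /r ge_min; case/andP: (of_levels_range x) => _ ->.
  rewrite of_levelsE//; apply/asboolP.
  have bx : box (a r) (b r) x by apply/asboolP; rewrite -of_levelsE// /r ge_min lexx.
  have bY : box (a r) (b r) y.
    by apply/asboolP; rewrite -of_levelsE// /r ge_min lexx orbT.
  move=> i; rewrite !mxE; case/andP: (bx i) => x1 x2; case/andP: (bY i) => y1 y2.
  have l1' : 0 <= 1 - l by rewrite subr_ge0.
  have := ler_wpM2l l0 x1; have := ler_wpM2l l0 x2.
  have := ler_wpM2l l1' y1; have := ler_wpM2l l1' y2.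
  by move=> ? ? ? ?; apply/andP; split; lra.
- move=> x c uxc; rewrite -/u.
  have [c1|c1] := ltP 1 c.
    by apply: (@nearW _ (nbhs x)) => y; case/andP: (of_levels_range y) => _ /le_lt_trans; apply.
  have c0 : 0 < c by case/andP: (of_levels_range x) => /le_lt_trans /(_ uxc).
  have : nbhs x (~` box (a c) (b c)).
    apply: open_nbhs_nbhs; split; first exact/closed_openC/box_closed.
    by move=> /asboolP; rewrite -of_levelsE// leNgt uxc.
  apply: (@filterS _ (nbhs x)) => y /= nb; rewrite ltNge of_levelsE//.
  by apply/negP => /asboolP.
- by rewrite level0; exact: box_compact.
Qed.

End of_levels.

Lemma cell_level_box (u : cellnum R n) r : 0 <= r <= 1 ->
  level u r = box (lo u ^~ r) (hi u ^~ r).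
Proof. by move=> ?; case: (cell_funP u) => _; exact. Qed.

Lemma cell_endpoints (u : cellnum R n) :
  endpoints (fun r i => lo u i r) (fun r i => hi u i r).
Proof.
have [fu _] := cell_funP u.
have pos r : 0 < r -> level u r = [set x | r <= u x].
  by move=> r0; rewrite /level gt_eqF.
have lmono r s : 0 <= r -> r <= s -> s <= 1 -> level u s `<=` level u r.
  rewrite le_eqVlt => /predU1P[<-|r0] rs s1; last first.
    by rewrite (pos _ r0) (pos _ (lt_le_trans r0 rs)) => x; exact: le_trans.
  move: rs; rewrite le_eqVlt => /predU1P[<-//|s0]; rewrite (pos _ s0).
  rewrite /level eqxx => x /= sx; apply: subset_closure => /=.
  exact: lt_le_trans sx.
have ne r : 0 <= r -> r <= 1 -> level u r !=set0.
  move=> r0 r1; have [x ux] := fuzzy_normal fu; exists x.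
  by apply: (lmono r 1) => //; rewrite pos//= ux.
have le r i : 0 <= r <= 1 -> lo u i r <= hi u i r.
  move=> r01; have /andP[r0 r1] := r01; have [x] := ne r r0 r1.
  by rewrite cell_level_box// => /(_ i)/andP[]; exact: le_trans.
have mono r s i : 0 <= r -> r <= s -> s <= 1 ->
    lo u i r <= lo u i s /\ hi u i s <= hi u i r.
  move=> r0 rs s1.
  have r01 : 0 <= r <= 1 by rewrite r0 (le_trans rs).
  have s01 : 0 <= s <= 1 by rewrite s1 (le_trans r0).
  have sub := lmono _ _ r0 rs s1.
  rewrite !cell_level_box// in sub.
  have /sub/(_ i)/andP[h1 _] : box (lo u ^~ s) (hi u ^~ s) (\row_j lo u j s).
    by apply: box_lo => j; exact: le.
  have /sub/(_ i)/andP[_ h2] : box (lo u ^~ s) (hi u ^~ s) (\row_j hi u j s).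
    by apply: box_hi => j; exact: le.
  by rewrite !mxE in h1 h2.
split => //.
- move=> r i e r0 r1 e0.
  have r01 : 0 <= r <= 1 by rewrite (ltW r0).
  have key (p : 'rV[R]_n) : ~ level u r p ->
      exists s, [/\ 0 <= s, s < r & ~ level u s p].
    rewrite (pos _ r0) /= => /negP; rewrite -ltNge => up.
    have /andP[up0 _] := fuzzy_range fu p.
    exists ((u p + r) / 2); split; [lra|lra|].
    by rewrite pos /=; [apply/negP; rewrite -ltNge; lra|lra].
  pose p : 'rV[R]_n := \row_j (if j == i then lo u i r - e else lo u j r).
  pose q : 'rV[R]_n := \row_j (if j == i then hi u i r + e else hi u j r).
  have [|s [s0 sr sp]] := key p.
    by rewrite cell_level_box// => /(_ i)/andP[]; rewrite mxE eqxx; lra.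
  have [|t [t0 tr tq]] := key q.
    by rewrite cell_level_box// => /(_ i)/andP[]; rewrite mxE eqxx; lra.
  have aux s' : 0 <= s' -> s' < r -> [/\ 0 <= s' <= 1,
      forall j, lo u j s' <= lo u j r <= hi u j r
      & forall j, hi u j r <= hi u j s'].
    move=> s'0 s'r; split; first by rewrite s'0 (le_trans (ltW s'r)).
      by move=> j; rewrite le// andbT; case: (mono s' r j s'0 (ltW s'r) r1).
    by move=> j; case: (mono s' r j s'0 (ltW s'r) r1).
  have hs : lo u i r - e < lo u i s.
    rewrite ltNge; apply/negP => h; apply: sp.
    have [s01 m1 m2] := aux _ s0 sr; rewrite cell_level_box// => j; rewrite mxE.
    have := m1 j; have := m2 j; case: eqP => [->|_] ? /andP[? ?];
      by apply/andP; split; lra.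
  have ht : hi u i t < hi u i r + e.
    rewrite ltNge; apply/negP => h; apply: tq.
    have [s01 m1 m2] := aux _ t0 tr; rewrite cell_level_box// => j; rewrite mxE.
    have := m1 j; have := m2 j; case: eqP => [->|_] ? /andP[? ?];
      by apply/andP; split; lra.
  exists (Num.max s t); split.
  + by rewrite le_max s0.
  + by rewrite gt_max sr tr.
  + apply: (lt_le_trans hs); apply: (mono s _ i s0 _ _).1.
      by rewrite le_max lexx.
    by rewrite ge_max !(le_trans (ltW _) r1).
  + apply: (le_lt_trans _ ht); apply: (mono t _ i t0 _ _).2.
      by rewrite le_max lexx orbT.
    by rewrite ge_max !(le_trans (ltW _) r1).
- move=> i e e0.
  have z01 : 0 <= (0:R) <= 1 by rewrite lexx ler01.
  have key (p : 'rV[R]_n) : level u 0 p -> exists y : 'rV[R]_n,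
      [/\ 0 < u y, u y <= 1, `|p 0 i - y 0 i| < e & level u (u y) y].
    rewrite /level eqxx => /(_ (ball p e) (nbhsx_ballx _ _ e0)) [y [/= uy py]].
    exists y; split => //; first by case/andP: (fuzzy_range fu y).
      by case: py => _ /(_ 0 i).
    by rewrite gt_eqF//=.
  have [|y [y0 y1 yp ly]] := key (\row_j lo u j 0).
    by rewrite cell_level_box//; apply: box_lo => j; exact: le.
  have [|z [z0 z1 zp lz]] := key (\row_j hi u j 0).
    by rewrite cell_level_box//; apply: box_hi => j; exact: le.
  rewrite !mxE !ltr_norml in yp zp.
  have uy01 : 0 <= u y <= 1 by rewrite (ltW y0).
  have uz01 : 0 <= u z <= 1 by rewrite (ltW z0).
  move: ly lz; rewrite !cell_level_box// => /(_ i)/andP[ly _] /(_ i)/andP[_ lz].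
  have h0 : 0 < Num.min (u y) (u z) by rewrite lt_min y0 z0.
  have hy : Num.min (u y) (u z) <= u y by rewrite ge_min lexx.
  have hz : Num.min (u y) (u z) <= u z by rewrite ge_min lexx orbT.
  exists (Num.min (u y) (u z)); split => //.
  + exact: le_trans hy y1.
  + by have [+ _] := mono _ _ i (ltW h0) hy y1; lra.
  + by have [_ +] := mono _ _ i (ltW h0) hz z1; lra.
Qed.

Lemma endpointsD a b a' b' : endpoints a b -> endpoints a' b' ->
  endpoints (fun r i => a r i + a' r i) (fun r i => b r i + b' r i).
Proof.
move=> ab ab'; split.
- by move=> r i r01; rewrite lerD// ep_le.
- move=> r s i r0 rs s1; have [? ?] := ep_mono ab i r0 rs s1.
  by have [? ?] := ep_mono ab' i r0 rs s1; rewrite !lerD.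
- move=> r i e r0 r1 e0; have e2 : 0 < e / 2 by lra.
  have [s [s0 sr h1 h2]] := ep_left ab i r0 r1 e2.
  have [t [t0 tr h3 h4]] := ep_left ab' i r0 r1 e2.
  have mr : Num.max s t < r by rewrite gt_max sr tr.
  have m1 := le_trans (ltW mr) r1.
  have sm : s <= Num.max s t by rewrite le_max lexx.
  have tm : t <= Num.max s t by rewrite le_max lexx orbT.
  have [? ?] := ep_mono ab i s0 sm m1; have [? ?] := ep_mono ab' i t0 tm m1.
  by exists (Num.max s t); split => //; [exact: le_trans sm|lra|lra].
- move=> i e e0; have e2 : 0 < e / 2 by lra.
  have [s [s0 s1 h1 h2]] := ep_right ab i e2.
  have [t [t0 t1 h3 h4]] := ep_right ab' i e2.
  have m0 : 0 < Num.min s t by rewrite lt_min s0 t0.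
  have ms : Num.min s t <= s by rewrite ge_min lexx.
  have mt : Num.min s t <= t by rewrite ge_min lexx orbT.
  have [? ?] := ep_mono ab i (ltW m0) ms s1.
  have [? ?] := ep_mono ab' i (ltW m0) mt t1.
  by exists (Num.min s t); split => //; [exact: le_trans s1|lra|lra].
Qed.

Lemma endpointsZ k a b : endpoints a b ->
  endpoints (fun r i => Num.min (k * a r i) (k * b r i))
            (fun r i => Num.max (k * a r i) (k * b r i)).
Proof.
move=> ab.
have minmax (x y : R) : Num.min x y <= Num.max x y.
  by rewrite ge_min le_max lexx.
have [k0|k0|k0] := ltgtP 0 k; last first.
- rewrite -k0; split.
  + by move=> r i _; exact: minmax.
  + by move=> r s i _ _ _; rewrite !mul0r !lexx.
  + by move=> r i e r0 _ e0; exists 0; rewrite !mul0r minxx maxxx; split => //; lra.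
  + by move=> i e e0; exists 1; rewrite !mul0r minxx maxxx; split => //; lra.
- have E (r : R) (i : 'I_n) : 0 <= r <= 1 -> (Num.min (k * a r i) (k * b r i) = k * b r i)
      * (Num.max (k * a r i) (k * b r i) = k * a r i).
    move=> r01; have h := ep_le ab i r01.
    have h' : k * b r i <= k * a r i by rewrite ler_nM2l.
    by rewrite (min_idPr h') (max_idPl h').
  split.
  + by move=> r i _; exact: minmax.
  + move=> r s i r0 rs s1.
    rewrite !E ?(le_trans r0 rs) ?r0 ?(le_trans rs s1)// !ler_nM2l//.
    by have [-> ->] := ep_mono ab i r0 rs s1.
  + move=> r i e r0 r1 e0.
    have e2 : 0 < e / - k by rewrite divr_gt0// oppr_gt0.
    have [s [s0 sr h1 h2]] := ep_left ab i r0 r1 e2.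
    exists s; rewrite !E ?s0 ?(le_trans (ltW sr) r1) ?(ltW r0)//.
    have ke : k * (e / - k) = - e by rewrite invrN mulrN mulrN mulrCA divff ?mulr1// lt_eqF.
    rewrite -(ltr_nM2l k0) in h1; rewrite -(ltr_nM2l k0) in h2.
    by rewrite mulrBr ke in h1; rewrite mulrDr ke in h2; split => //; lra.
  + move=> i e e0.
    have e2 : 0 < e / - k by rewrite divr_gt0// oppr_gt0.
    have [s [s0 s1 h1 h2]] := ep_right ab i e2.
    exists s; rewrite !E ?(ltW s0) ?lexx ?ler01//.
    have ke : k * (e / - k) = - e by rewrite invrN mulrN mulrN mulrCA divff ?mulr1// lt_eqF.
    rewrite -(ltr_nM2l k0) in h1; rewrite -(ltr_nM2l k0) in h2.
    by rewrite mulrDr ke in h1; rewrite mulrBr ke in h2; split => //; lra.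
- have E (r : R) (i : 'I_n) : 0 <= r <= 1 -> (Num.min (k * a r i) (k * b r i) = k * a r i)
      * (Num.max (k * a r i) (k * b r i) = k * b r i).
    move=> r01; have h := ep_le ab i r01.
    have h' : k * a r i <= k * b r i by rewrite ler_pM2l.
    by rewrite (min_idPl h') (max_idPr h').
  split.
  + by move=> r i _; exact: minmax.
  + move=> r s i r0 rs s1.
    rewrite !E ?(le_trans r0 rs) ?r0 ?(le_trans rs s1)// !ler_pM2l//.
    by have [-> ->] := ep_mono ab i r0 rs s1.
  + move=> r i e r0 r1 e0.
    have e2 : 0 < e / k by rewrite divr_gt0.
    have [s [s0 sr h1 h2]] := ep_left ab i r0 r1 e2.
    exists s; rewrite !E ?s0 ?(le_trans (ltW sr) r1) ?(ltW r0)//.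
    have ke : k * (e / k) = e by rewrite mulrCA divff ?mulr1// gt_eqF.
    rewrite -(ltr_pM2l k0) in h1; rewrite -(ltr_pM2l k0) in h2.
    by rewrite mulrBr ke in h1; rewrite mulrDr ke in h2; split => //; lra.
  + move=> i e e0.
    have e2 : 0 < e / k by rewrite divr_gt0.
    have [s [s0 s1 h1 h2]] := ep_right ab i e2.
    exists s; rewrite !E ?(ltW s0) ?lexx ?ler01//.
    have ke : k * (e / k) = e by rewrite mulrCA divff ?mulr1// gt_eqF.
    rewrite -(ltr_pM2l k0) in h1; rewrite -(ltr_pM2l k0) in h2.
    by rewrite mulrDr ke in h1; rewrite mulrBr ke in h2; split => //; lra.
Qed.

Lemma endpoints0 : endpoints (fun _ _ => 0 : R) (fun _ _ => 0 : R).
Proof.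
split => //.
- by move=> r i e r0 _ e0; exists 0; split => //; lra.
- by move=> i e e0; exists 1; split => //; lra.
Qed.

End levels.

Section operations.
Context {R : realType} {n : nat}.
Implicit Types (u v w : cellnum R n) (k r : R).

Let addA u v r := set_add (level u r) (level v r).

Let addA_box u v r : 0 <= r <= 1 ->
  addA u v r = box (fun i => lo u i r + lo v i r) (fun i => hi u i r + hi v i r).
Proof.
move=> r01; rewrite /addA !cell_level_box// set_add_box// => i.
  exact: (ep_le (cell_endpoints u)).
exact: (ep_le (cell_endpoints v)).
Qed.

Let addE u v := endpointsD (cell_endpoints u) (cell_endpoints v).

Definition cell_add u v : cellnum R n :=
  CellNum (is_cell_of_levels (addE u v) (@addA_box u v)).

Lemma level_cell_add u v r : 0 <= r <= 1 ->
  level (cell_add u v) r = set_add (level u r) (level v r).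
Proof. exact: level_of_levels (addE u v) (@addA_box u v) r. Qed.

Let scaleA k u r := set_scale k (level u r).

Let scaleA_box k u r : 0 <= r <= 1 -> scaleA k u r =
  box (fun i => Num.min (k * lo u i r) (k * hi u i r))
      (fun i => Num.max (k * lo u i r) (k * hi u i r)).
Proof.
move=> r01; rewrite /scaleA !cell_level_box// set_scale_box// => i.
exact: (ep_le (cell_endpoints u)).
Qed.

Let scaleE k u := endpointsZ k (cell_endpoints u).

Definition cell_scale k u : cellnum R n :=
  CellNum (is_cell_of_levels (scaleE k u) (@scaleA_box k u)).

Lemma level_cell_scale k u r : 0 <= r <= 1 ->
  level (cell_scale k u) r = set_scale k (level u r).
Proof. exact: level_of_levels (scaleE k u) (@scaleA_box k u) r. Qed.

Lemma is_cell_indic0 : is_cell (\1_[set 0] : 'rV[R]_n -> R).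
Proof.
have box0 r : 0 <= r <= 1 ->
    [set 0 : 'rV[R]_n] = box (fun=> 0) (fun=> 0).
  move=> _; apply/seteqP; split=> [_ -> i|x bx]; first by rewrite mxE lexx.
  by apply/rowP => i; apply/eqP; rewrite mxE eq_le andbC; exact: bx.
suff -> : \1_[set 0] = of_levels (fun=> [set 0 : 'rV[R]_n]).
  exact: is_cell_of_levels endpoints0 box0.
apply/funext => x; have [->|x0] := eqVneq x 0.
  apply/eqP; rewrite indicE mem_set// eq_le.
  have /andP[_ ->] := of_levels_range (fun=> [set 0 : 'rV[R]_n]) 0.
  by rewrite andbT (of_levelsE endpoints0 box0)//; apply/asboolP; rewrite -(box0 1)// ler01 lexx.
rewrite indicE memNset; last by move=> /= xE; rewrite xE eqxx in x0.
rewrite /of_levels; set S := [set _ | _]; suff -> : S = set0 by rewrite sup0.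
by apply/seteqP; split => // r [_ /= xE]; rewrite xE eqxx in x0.
Qed.

Definition cell_zero : cellnum R n := CellNum is_cell_indic0.

Definition cell_le u v := forall i r, 0 <= r <= 1 ->
  lo u i r <= lo v i r /\ hi u i r <= hi v i r.

Definition cell_dot (m : nat) (v : 'I_m -> cellnum R n) (d : 'rV[R]_m) :
    cellnum R n :=
  \big[cell_add/cell_zero]_(j < m) cell_scale (d 0 j) (v j).

(* w is the g-difference of u and v: the gH-difference C beta of the level
   sets is required to exist at every beta in [0, 1], and w to be an n-cell
   number. *)
Definition is_gdiff u v w := exists C : R -> set 'rV[R]_n,
  (forall beta, 0 <= beta <= 1 ->
     is_gHdiff (level u beta) (level v beta) (C beta)) /\
  (forall r, 0 <= r <= 1 ->
     level w r =
       closure (conv_hull (\bigcup_(beta in [set beta | r <= beta <= 1]) C beta))).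

End operations.

Section subdifferential.
Context {R : realType} {m n : nat}.
Variables (M : set 'rV[R]_m) (F : 'rV[R]_m -> cellnum R n).

Definition cell_convex := forall x y (l : R), M x -> M y -> 0 <= l <= 1 ->
  cell_le (F (l *: x + (1 - l) *: y))
          (cell_add (cell_scale l (F x)) (cell_scale (1 - l) (F y))).

Definition is_minimum (x0 : 'rV[R]_m) := forall x, M x -> cell_le (F x0) (F x).

Definition subdifferential (t : 'rV[R]_m) : set ('I_m -> cellnum R n) :=
  [set v | forall z, M z ->
     exists w, is_gdiff (F z) (F t) w /\ cell_le (cell_dot v (z - t)) w].

End subdifferential.

(* Main.v *)
Require Import Defs.
From mathcomp Require Import all_boot all_order all_algebra.
From mathcomp Require Import all_classical all_reals all_analysis.
From mathcomp Require Import lra.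

Import Order.TTheory GRing.Theory Num.Theory.
Import numFieldNormedType.Exports.

Local Open Scope classical_set_scope.
Local Open Scope ring_scope.

(** Both sides of the equivalence say that every level set of the g-difference
    [F z - F x0] lies in the nonnegative orthant. In either of its two cases, a
    gH-difference of boxes has as endpoints the differences of the endpoints,
    possibly swapped, so it lies in the orthant exactly when the boxes are
    ordered; and the orthant being convex and closed, containment passes to the
    closed convex hull of the union of these differences. *)

Section boxes.
Context {R : realType} {n : nat}.
Implicit Types (a b : 'I_n -> R) (A C : set 'rV[R]_n).

(** Both boxes are nonempty, so each endpoint is recovered as the infimum or supremum of a
    coordinate. *)
Lemma box_inj a b a' b' : (forall i, a i <= b i) -> (forall i, a' i <= b' i) ->
  box a b = box a' b' -> a = a' /\ b = b'.
Proof.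
move=> ab ab' E; split; apply/funext => i.
  by rewrite -(inf_box i ab) E inf_box.
by rewrite -(sup_box i ab) E sup_box.
Qed.

Definition orthant : set 'rV[R]_n := [set x | forall i, 0 <= x 0 i].

Lemma orthant_convex : convex_set orthant.
Proof.
move=> x y l; rewrite !inE => x0 y0 i.
rewrite !mxE; apply: addr_ge0; apply: mulr_ge0; rewrite ?x0 ?y0//.
by rewrite /unstable.onem subr_ge0.
Qed.

Lemma orthant_closed : closed orthant.
Proof.
have -> : orthant = \bigcap_(i in [set: 'I_n]) [set x : 'rV[R]_n | 0 <= x 0 i].
  by apply/seteqP; split => x x0 i; [move=> _; exact: x0|exact: (x0 i I)].
apply: closed_bigI => i _.
apply: (@preimage_closed _ _ (fun x : 'rV[R]_n => x 0 i) [set t | 0 <= t]).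
  by move=> x _; exact: coord_continuous.
exact: closed_ge.
Qed.

Lemma closure_hull_sub_orthant A :
  (closure (conv_hull A) `<=` orthant) <-> (A `<=` orthant).
Proof.
split => [h x Ax|h].
  by apply: h; apply: subset_closure => B [_]; exact.
rewrite [X in _ `<=` X](closure_id _).1; last exact: orthant_closed.
(* The orthant is itself one of the convex supersets of [A] whose intersection is the hull. *)
apply: closureS => x; apply; split => //; exact: orthant_convex.
Qed.

Lemma box_sub_orthant a b : (forall i, a i <= b i) ->
  (box a b `<=` orthant) <-> (forall i, 0 <= a i).
Proof.
move=> ab; split => [h i|a0 x bx i]; last first.
  by case/andP: (bx i) => + _; exact: le_trans.
by have /h/(_ i) := box_lo ab; rewrite mxE.
Qed.

(** Write [C] as the box from [c] to [d]. In the first case [c = a - a'] and [d = b - b']; in the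
    second the roles swap, [d = a - a'] and [c = b - b']. Either way [c <= d], so both differences
    are nonnegative as soon as [c] is. *)
Lemma gHdiff_sub_orthant a b a' b' C :
  (forall i, a i <= b i) -> (forall i, a' i <= b' i) ->
  is_gHdiff (box a b) (box a' b') C ->
  (C `<=` orthant) <-> (forall i, a' i <= a i /\ b' i <= b i).
Proof.
move=> ab ab' [[c [d [cd ->]]] H].
rewrite box_sub_orthant//.
case: H.
  rewrite set_add_box// => /box_inj [||-> ->]//.
    by move=> i; rewrite lerD.
  split => [c0 i|h i]; last by have [+ _] := h i; lra.
  by have := c0 i; have := cd i; split; lra.
rewrite set_scale_box// set_add_box//; last first.
  by move=> i; rewrite ge_min le_max lexx.
have minE i : Num.min (-1 * c i) (-1 * d i) = - d i.
  by have := cd i; rewrite /Num.min; case: ltP; lra.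
have maxE i : Num.max (-1 * c i) (-1 * d i) = - c i.
  by have := cd i; rewrite /Num.max; case: ltP; lra.
move=> /box_inj [||-> ->]//.
  by move=> i; rewrite lerD// ge_min le_max lexx.
split => [c0 i|h i]; last by have [_] := h i; rewrite maxE; lra.
by have := c0 i; have := cd i; rewrite minE maxE; split; lra.
Qed.

End boxes.

Section cell_numbers.
Context {R : realType} {n : nat}.
Implicit Types (u v w : cellnum R n).

Lemma level_cell_zero r : 0 <= r <= 1 ->
  level (cell_zero : cellnum R n) r = [set 0].
Proof.
move=> /andP[r0 r1]; rewrite /level /cell_zero/=; case: eqVneq => [_|rn].
  (* At [r = 0] the level set is the closure of the support, here a singleton, which is already
     closed. *)
  have -> : [set x | 0 < \1_[set (0 : 'rV[R]_n)] x :> R] = [set 0].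
    apply/seteqP; split=> x /=; rewrite indicE.
      by case: (boolP (x \in _)) => [/set_mem//|]; rewrite ltxx.
    by move=> ->; rewrite mem_set.
  rewrite -(closure_id _).1//.
  exact/accessible_closed_set1/hausdorff_accessible/norm_hausdorff.
have {rn}r0 : 0 < r by rewrite lt_neqAle eq_sym rn.
apply/seteqP; split=> x /=; rewrite indicE.
  by case: (boolP (x \in _)) => [/set_mem//|_ /=]; rewrite leNgt r0.
by move=> ->; rewrite mem_set.
Qed.

Lemma level_cell_dot0 (m : nat) (d : 'rV[R]_m) r : 0 <= r <= 1 ->
  level (cell_dot (fun=> cell_zero : cellnum R n) d) r = [set 0].
Proof.
move=> r01; rewrite /cell_dot.
(* The induction carries only the level set at [r], avoiding any equality between cell numbers. *)
elim/big_ind : _ => [|u v u0 v0|j _]; first exact: level_cell_zero.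
  rewrite level_cell_add// u0 v0; apply/seteqP; split=> x /=.
    by move=> [_ -> [_ -> <-]]; rewrite addr0.
  by move=> ->; exists 0 => //; exists 0; rewrite ?addr0.
by rewrite level_cell_scale// level_cell_zero// /set_scale image_set1 scaler0.
Qed.

Lemma cell_dot0_le (m : nat) (d : 'rV[R]_m) w :
  cell_le (cell_dot (fun=> cell_zero) d) w <->
  (forall r, 0 <= r <= 1 -> level w r `<=` orthant).
Proof.
have lohi i r : 0 <= r <= 1 -> lo w i r <= hi w i r.
  exact: (ep_le (cell_endpoints w)).
split => h.
  move=> r r01; rewrite cell_level_box//.
  rewrite box_sub_orthant; last by move=> i; exact: lohi.
  move=> i; have [+ _] := h i r r01.
  by rewrite /lo level_cell_dot0// image_set1 mxE inf1.
move=> i r r01; have := h r r01; rewrite cell_level_box//.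
rewrite box_sub_orthant; last by move=> j; exact: lohi.
(* Nonnegativity of the upper endpoint follows from that of the lower one. *)
move=> /(_ i) w0; have := lohi i r r01.
rewrite {2}/lo {2}/hi level_cell_dot0// image_set1 mxE inf1 sup1 => ?.
by split => //; exact: le_trans w0 _.
Qed.

Lemma gdiff_sub_orthant u v w : is_gdiff u v w ->
  (forall r, 0 <= r <= 1 -> level w r `<=` orthant) <-> cell_le v u.
Proof.
move=> [C [CP wE]].
have CE r : 0 <= r <= 1 -> (C r `<=` orthant) <->
    (forall i, lo v i r <= lo u i r /\ hi v i r <= hi u i r).
  move=> r01; apply: gHdiff_sub_orthant.
  - by move=> i; exact: (ep_le (cell_endpoints u)).
  - by move=> i; exact: (ep_le (cell_endpoints v)).
  - by rewrite -!cell_level_box//; exact: CP.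
split => h.
  move=> i r r01; move: i; apply/CE => // x Cx.
  have /andP[_ r1] := r01; have := h r r01; rewrite wE//.
  (* The term [beta = r] of the union gives the order at level [r]. *)
  by move=> /closure_hull_sub_orthant; apply; exists r; rewrite /= ?lexx.
move=> r /andP[r0 r1]; rewrite wE ?r0//; apply/closure_hull_sub_orthant.
(* Conversely, level [r] of [w] collects the differences at all levels [s >= r], so the order is
   used at each of them. *)
move=> x [s /andP[rs s1]]; have s01 : 0 <= s <= 1 by rewrite (le_trans r0).
by apply: (CE s s01).2 => i; exact: h.
Qed.

End cell_numbers.

Theorem theorem3p33 (R : realType) (m n : nat) (M : set 'rV[R]_m)
    (F : 'rV[R]_m -> cellnum R n) (x0 : 'rV[R]_m)
    (M_nonempty : M !=set0) (M_convex : convex_set M)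
    (F_convex : cell_convex M F) (M_x0 : M x0)
    (gdiff_exists : forall z, M z -> exists w, is_gdiff (F z) (F x0) w) :
  is_minimum M F x0 <-> subdifferential M F x0 (fun=> cell_zero).
Proof.
split => [min z Mz|sub z Mz].
  have [w gw] := gdiff_exists z Mz; exists w; split => //.
  by apply/cell_dot0_le; apply: (gdiff_sub_orthant _ _ _ gw).2; exact: min.
(* Here the g-difference comes with the subgradient inequality itself. *)
have [w [gw /cell_dot0_le w0]] := sub z Mz; exact: (gdiff_sub_orthant _ _ _ gw).1.
Qed.
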